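(* For every positive integer $k$ there are integers $m,n<2k^2$ and matrices $A\in\{0,\pm 1\}^{m\times n}$ and $W\in\mathbb{Z}_+^{2\times n}$ with $\log \|W\|_\infty <2k$, such that the projection by $W$ of the $\{0,1\}$-polytope $Q:={\rm conv}\{x\in\mathbb{Z}^n : Ax=0,\ 0\le x\le 1\}$ into the plane $\mathbb{R}^2$ (i.e., $\{Wx : x\in Q\}$) has exactly $2^k$ vertices.
   Context: $\|W\|_\infty:=\max_{i,j}|W_{i,j}|$; the inequalities $0\le x\le 1$ are componentwise. *)

(* Defs.v *)
From HB Require Import structures.
From mathcomp Require Import all_boot all_order all_algebra.
From mathcomp Require Import all_classical all_reals all_analysis.

Set Implicit Arguments.
Unset Strict Implicit.
Unset Printing Implicit Defensive.

Import Order.TTheory GRing.Theory Num.Theory.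
Import numFieldNormedType.Exports.

Local Open Scope classical_set_scope.
Local Open Scope ring_scope.

(* The logarithm is taken in base 2 (bit size); note that ln 0 = 0. *)
Definition log2 (R : realType) (x : R) : R := ln x / ln 2.

Definition conv (R : realType) (n : nat) (S : set 'cV[R]_n) : set 'cV[R]_n :=
  smallest (fun C : set (convex_lmodType 'cV[R]_n) => convex_set C) S.

(* Vertices are the 0-dimensional faces: the points that are the unique
   maximizer over P of some linear functional y |-> c y. *)
Definition vertices (R : realType) (n : nat) (P : set 'cV[R]_n) :
    set 'cV[R]_n :=
  [set v | P v /\ exists c : 'rV[R]_n,
     forall y, P y -> y <> v -> (c *m y) 0 0 < (c *m v) 0 0].

Definition intmx (R : realType) (m n : nat) (M : 'M[int]_(m, n)) :
    'M[R]_(m, n) := map_mx intr M.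
Arguments intmx R {m n} M.

Definition polytopeQ (R : realType) (m n : nat) (A : 'M[int]_(m, n)) :
    set 'cV[R]_n :=
  conv [set intmx R x | x in
    [set x : 'cV[int]_n | A *m x = 0 /\ forall i, 0 <= x i 0 <= 1]].
Arguments polytopeQ R {m n} A.

(* Main.v *)
(** The points [(v, v^2)] with [v < 2^k] are in convex position, so it suffices
    to write [v] and [v^2] as nonnegative linear functions on a 0/1 polytope.
    With binary digits [x_i] one has [v = sum_i 2^i x_i] and
    [v^2 = sum_i 4^i x_i + sum_(i < j) 2^(i+j+1) x_i x_j], and each product is
    linearized by a 2x2 contingency table of 0/1 variables whose row and column
    sums are [x_i], [t - x_i], [x_j], [t - x_j]. The extra 0/1 variable [t]
    stands for the constant 1, which makes the equations homogeneous; [t = 0]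
    forces the projection to be the origin, which is the point for [v = 0]. *)
Require Import Defs.
From HB Require Import structures.
From mathcomp Require Import all_boot all_order all_algebra.
From mathcomp Require Import all_classical all_reals all_analysis.
From mathcomp Require Import ring lra zify.

Set Implicit Arguments.
Unset Strict Implicit.
Unset Printing Implicit Defensive.

Import Order.TTheory GRing.Theory Num.Theory.
Import numFieldNormedType.Exports.

Local Open Scope classical_set_scope.
Local Open Scope card_scope.
Local Open Scope ring_scope.

(** * Linear functionals on convex hulls *)

Lemma convex_combE (R : realType) (M : lmodType R) (x y : convex_lmodType M)
    (l : {i01 R}) :
  convex.conv l x y = l%:num *: (x : M) + (1 - l%:num) *: (y : M) :> M.
Proof. by []. Qed.

Lemma mx_lincombE (R : pzRingType) (m n : nat) (a b : R) (A B : 'M[R]_(m, n))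
    i j :
  (a *: A + b *: B) i j = a * A i j + b * B i j.
Proof. by rewrite !mxE. Qed.

Lemma convex_comb_lt (R : realFieldType) (t p q b : R) :
  0 <= t <= 1 -> p < b -> q < b -> t * p + (1 - t) * q < b.
Proof. by move=> /andP[t0 t1] pb qb; case: (lerP p q) => pq; nra. Qed.

Lemma conv_lt (R : realType) (n : nat) (S : set 'cV[R]_n) (c : 'rV[R]_n) b :
  (forall s, S s -> (c *m s) 0 0 < b) ->
  forall x, Defs.conv S x -> (c *m x) 0 0 < b.
Proof.
move=> cS; apply: (@smallest_sub _ _ S [set x | (c *m x) 0 0 < b]) => //.
move=> x y l /set_mem /= cx /set_mem /= cy; apply/mem_set => /=.
rewrite convex_combE mulmxDr -!scalemxAr mx_lincombE.
by apply: convex_comb_lt => //; rewrite ge0 le1.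
Qed.

(** The fibre over [v] together with an open half-space is convex, so being the unique maximizer
    passes from the generators to the hull. *)
Lemma conv_eq_or_lt (R : realType) (m n : nat) (S : set 'cV[R]_n)
    (W : 'M[R]_(m, n)) (c : 'rV[R]_m) (v : 'cV[R]_m) :
  (forall s, S s -> W *m s = v \/ (c *m (W *m s)) 0 0 < (c *m v) 0 0) ->
  forall x, Defs.conv S x ->
    W *m x = v \/ (c *m (W *m x)) 0 0 < (c *m v) 0 0.
Proof.
move=> cS; apply: (@smallest_sub _ _ S
  [set x | W *m x = v \/ (c *m (W *m x)) 0 0 < (c *m v) 0 0]) => //.
move=> x y l /set_mem /= cx /set_mem /= cy; apply/mem_set => /=.
rewrite convex_combE mulmxDr -!scalemxAr.
have : 0 <= l%:num <= 1 by rewrite ge0 le1.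
move: (l%:num) => t /andP[t0 t1].
(* At [t = 0] or [t = 1] one point has no weight, so its strict inequality would be lost. *)
case: (eqVneq t 0) => [->|tn0].
  by rewrite subr0 scale0r add0r scale1r.
case: (eqVneq t 1) => [->|tn1].
  by rewrite subrr scale0r addr0 scale1r.
have {}t0 : 0 < t by rewrite lt_neqAle eq_sym tn0.
have {}t1 : t < 1 by rewrite lt_neqAle tn1.
rewrite mulmxDr -!scalemxAr mx_lincombE.
case: cx => [->|cx]; case: cy => [->|cy]; [left|right; nra..].
by rewrite -scalerDl addrC subrK scale1r.
Qed.

(** * Vertices of a projection onto points of the parabola *)

Definition parabola_point (R : pzRingType) (x : R) : 'cV[R]_2 :=
  \col_i x ^+ i.+1.

Definition parabola_tangent (R : pzRingType) (v : R) : 'rV[R]_2 :=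
  \row_i (if i == 0 then v *+ 2 else -1).

Lemma intmx_mul (R : realType) (m n p : nat) (A : 'M[int]_(m, n))
    (B : 'M[int]_(n, p)) : intmx R (A *m B) = intmx R A *m intmx R B.
Proof. exact: map_mxM. Qed.

Lemma intmx_parabola_point (R : realType) (v : nat) :
  intmx R (parabola_point v%:Z) = parabola_point v%:R.
Proof. by apply/matrixP => i j; rewrite !mxE rmorphXn. Qed.

Lemma parabola_point_inj (R : pzRingType) : injective (@parabola_point R).
Proof. by move=> x y /matrixP /(_ 0 0); rewrite !mxE !expr1. Qed.

(* The tangent line at [v] supports the parabola strictly:
   2vu - u^2 = v^2 - (u - v)^2. *)
Lemma parabola_point_exposed (R : realFieldType) (u v : R) : u != v ->
  (parabola_tangent v *m parabola_point u) 0 0 <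
  (parabola_tangent v *m parabola_point v) 0 0.
Proof.
move=> uv; rewrite !mxE !big_ord_recl !big_ord0 !mxE /= !expr1.
have : 0 < (u - v) ^+ 2 by rewrite lt_neqAle sqr_ge0 eq_sym sqrf_eq0 subr_eq0 uv.
by rewrite /= !exprS expr0; nra.
Qed.

Lemma vertices_parabola (R : realType) (m n : nat) (A : 'M[int]_(m, n))
    (W : 'M[int]_(2, n)) (N : nat) :
  (forall x : 'cV[int]_n, A *m x = 0 -> (forall i, 0 <= x i 0 <= 1) ->
     exists2 v, (v < N)%N & W *m x = parabola_point v%:Z) ->
  (forall v, (v < N)%N -> exists x : 'cV[int]_n,
     [/\ A *m x = 0, forall i, 0 <= x i 0 <= 1 & W *m x = parabola_point v%:Z]) ->
  vertices [set intmx R W *m x | x in polytopeQ R A] #= `I_N.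
Proof.
move=> onP ontoP.
suff -> : vertices [set intmx R W *m x | x in polytopeQ R A] =
    [set parabola_point (v%:R : R) | v in `I_N].
  apply: inj_card_eq => u v _ _ /parabola_point_inj /eqP.
  by rewrite eqr_nat => /eqP.
apply/seteqP; split => [y [[x Qx <-]] [c cmax]|_ [v /= vN <-]].
  (* If [y] is not one of the points, no generator maps to it, so [c] is strictly below its value at
     [y] on all generators, hence at [x], which maps to [y]. *)
  apply: contrapT => yN.
  suff : (c *m intmx R W *m x) 0 0 < (c *m (intmx R W *m x)) 0 0.
    by rewrite mulmxA ltxx.
  apply: conv_lt Qx => _ [s [As s01] <-].
  have [u uN Wu] := onP s As s01.
  rewrite -mulmxA; apply: cmax.
    exists (intmx R s) => //.
    by apply: (@sub_smallest _ _ _ _ (fun _ h => h)); exists s.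
  by rewrite -intmx_mul Wu intmx_parabola_point => uE; apply: yN; exists u.
split.
  have [x [Ax x01 Wx]] := ontoP v vN.
  exists (intmx R x); last by rewrite -intmx_mul Wx intmx_parabola_point.
  apply: (@sub_smallest _ _ _ _ (fun _ h => h)).
  by exists x.
exists (parabola_tangent v%:R) => y [x Qx <-] xv.
suff [//|//] : intmx R W *m x = parabola_point v%:R \/
  (parabola_tangent v%:R *m (intmx R W *m x)) 0 0 <
  (parabola_tangent v%:R *m parabola_point v%:R) 0 0.
apply: conv_eq_or_lt Qx => _ [s [As s01] <-].
have [u uN Wu] := onP s As s01.
rewrite -intmx_mul Wu intmx_parabola_point.
by have [->|uv] := eqVneq (u%:R : R) v%:R; [left|right; apply: parabola_point_exposed].
Qed.

(** * Squares of sums, binary digits and enumerated matrices *)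

Lemma sqr_sum_lt (R : comPzRingType) (k : nat) (f : 'I_k -> R) :
  (\sum_i f i) ^+ 2 =
  \sum_i f i ^+ 2 + (\sum_(p : 'I_k * 'I_k | (p.1 < p.2)%N) f p.1 * f p.2) *+ 2.
Proof.
rewrite expr2 big_distrlr /= pair_big /= (bigID (fun p => p.1 == p.2)) /=.
congr (_ + _).
  rewrite (reindex_onto (fun i => (i, i)) fst) /=.
    by apply: eq_big => [i|i _]; rewrite ?eqxx ?expr2.
  by move=> [i j] /= /eqP ->.
rewrite (bigID (fun p : 'I_k * 'I_k => (p.1 < p.2)%N)) /= mulr2n; congr (_ + _).
  by apply: eq_bigl => -[i j] /=; rewrite -val_eqE /= neq_ltn; case: ltngtP.
rewrite (reindex_inj (h := fun p : 'I_k * 'I_k => (p.2, p.1))) /=.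
  apply: eq_big => [[i j]|[i j] _] /=; last by rewrite mulrC.
  by rewrite -val_eqE /=; case: ltngtP.
by move=> [i j] [i' j'] [-> ->].
Qed.

Lemma binary_expansion (k v : nat) : (v < 2 ^ k)%N ->
  exists b : nat -> bool, v = (\sum_(i < k) 2 ^ i * b i)%N.
Proof.
elim: k v => [|k IH] v.
  by rewrite ltnS leqn0 => /eqP ->; exists (fun=> false); rewrite big_ord0.
rewrite expnS => vlt; pose c := (2 ^ k <= v)%N.
have [|b bE] := IH (v - 2 ^ k * c)%N; first by rewrite /c; case: leqP; lia.
exists (fun i => if (i < k)%N then b i else c).
rewrite big_ord_recr /= ltnn (eq_bigr (fun i : 'I_k => 2 ^ i * b i)%N).
  by rewrite -bE subnK // /c; case: leqP; lia.
by move=> i _; rewrite ltn_ord.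
Qed.

Lemma binary_lt (k : nat) (b : 'I_k -> nat) : (forall i, b i <= 1)%N ->
  (\sum_(i < k) 2 ^ i * b i < 2 ^ k)%N.
Proof.
elim: k b => [|k IH] b b1; first by rewrite big_ord0.
rewrite big_ord_recr /= expnS.
have := IH _ (fun i => b1 (widen_ord (leqnSn k) i)).
have := b1 ord_max.
move: (\sum_(i < k) _)%N => s; nia.
Qed.

Lemma mulmx_enum (m : nat) (J : finType) (a : 'I_m -> J -> int)
    (x : 'cV[int]_#|J|) i :
  ((\matrix_(i < m, j < #|J|) a i (enum_val j)) *m x) i 0 =
  \sum_t a i t * x (enum_rank t) 0.
Proof.
rewrite mxE (reindex (@enum_val J predT)) /=; last exact/onW_bij/enum_val_bij.
by apply: eq_bigr => j _; rewrite mxE enum_valK.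
Qed.

(** * The system of contingency tables and the weights *)

Definition pairs (k : nat) : finType :=
  {p : 'I_k * 'I_k | (p.1 < p.2)%N} : finType.

(* The variables are a unit [t], the bits [x_i], and for each pair [i < j] and
   truth values [e], [f] the indicator of [x_i = e] and [x_j = f]. *)
Definition vars (k : nat) : finType :=
  (unit + ('I_k + pairs k * (bool * bool)))%type.

(* For each pair [i < j]: the four indicators sum to [t], those with [e] true
   to [x_i], and those with [f] true to [x_j]. *)
Definition eqns (k : nat) : finType := (pairs k * option bool)%type.

(** [None] is the total, [Some true] and [Some false] the sums for the first and second index. The
    sums for [t - x_i] and [t - x_j] follow by subtraction, so three equations per pair suffice. *)
Definition eqn_coef (k : nat) (r : eqns k) (c : vars k) : int :=
  match c with
  | inl _ => (r.2 == None)%:Z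
  | inr (inl i) => match r.2 with
    | None => 0
    | Some e => (i == if e then (val r.1).1 else (val r.1).2)%:Z
    end
  | inr (inr (q, (e, f))) =>
    - ((q == r.1) && match r.2 with
       | None => true | Some true => e | Some false => f end)%:Z
  end.

(** The exponent [i.+1 * j] gives [2^j] in row 0 and [4^j] in row 1; the cell [(true, true)] stands
    for the product of two bits and carries the cross term of the square. *)
Definition weight (k : nat) (i : 'I_2) (c : vars k) : int :=
  match c with
  | inr (inl j) => 2 ^+ (i.+1 * j)
  | inr (inr (p, (true, true))) =>
      if i == 0 then 0 else 2 ^+ ((val p).1 + (val p).2).+1
  | _ => 0
  end.

Lemma sum_vars (k : nat) (F : vars k -> int) :
  \sum_t F t = F (inl tt) + (\sum_i F (inr (inl i)) +
    \sum_p (F (inr (inr (p, (true, true)))) + F (inr (inr (p, (true, false))))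
      + F (inr (inr (p, (false, true)))) + F (inr (inr (p, (false, false)))))).
Proof.
rewrite big_sumType /= (big_pred1 tt); last by case.
rewrite big_sumType /=; congr (_ + (_ + _)).
transitivity (\sum_(p : pairs k) \sum_(e : bool) \sum_(f : bool)
    F (inr (inr (p, (e, f))))); last first.
  by apply: eq_bigr => p _; rewrite !big_bool /= addrA.
under [RHS]eq_bigr do rewrite pair_big.
by rewrite pair_big; apply: eq_bigr => -[p [e f]].
Qed.

Section Solutions.
Variables (k : nat) (X : vars k -> int).
Local Notation T := (X (inl tt)).
Local Notation B i := (X (inr (inl i))).
Local Notation C p e f := (X (inr (inr (p, (e, f))))).

Lemma sum_eqn_coef (r : eqns k) : \sum_t eqn_coef r t * X t =
  match r.2 with
  | None => T - (C r.1 true true + C r.1 true false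
                  + C r.1 false true + C r.1 false false)
  | Some true => B (val r.1).1 - (C r.1 true true + C r.1 true false)
  | Some false => B (val r.1).2 - (C r.1 true true + C r.1 false true)
  end.
Proof.
case: r => p e; rewrite sum_vars /= [\sum_(_ : pairs k) _](bigD1 p) //=.
rewrite eqxx /= [\sum_(_ | _ != _) _]big1; last first.
  by move=> q /negPf -> /=; rewrite !mulNr !mul0r !oppr0 !addr0.
case: e => [e|] /=; last first.
  rewrite big1 => [|i _]; last by rewrite mul0r.
  by ring.
rewrite (bigD1 (if e then (val p).1 else (val p).2)) //= eqxx big1.
  by case: e => /=; ring.
by move=> i /negPf ->; rewrite mul0r.
Qed.

(** A bit equals its own square, so the diagonal of the squared sum is linear in the bits. *)
Lemma sum_weight (i : 'I_2) :
  (forall j, B j = 0 \/ B j = 1) ->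
  (forall p, C p true true = B (val p).1 * B (val p).2) ->
  \sum_t weight i t * X t = (\sum_(j < k) 2 ^+ j * B j) ^+ i.+1.
Proof.
move=> B01 CB; rewrite sum_vars /= mul0r add0r.
under [X in _ + X]eq_bigr do rewrite !mul0r !addr0 CB.
case: i => -[|[|//]] lti /=.
  rewrite [X in _ + X]big1 => [|p _]; last by rewrite mul0r.
  by rewrite addr0 expr1; apply: eq_bigr => j _; rewrite mul1n.
rewrite sqr_sum_lt; congr (_ + _).
  apply: eq_bigr => j _; rewrite exprMn -exprM mulnC.
  by case: (B01 j) => ->.
rewrite -sumrMnl [RHS]big_sub /=.
apply: eq_bigr => p _.
by rewrite exprS exprD; ring.
Qed.
End Solutions.

(** This is the expansion of the square of a sum of [k] ones. *)
Lemma card_pairs (k : nat) : (#|pairs k| * 2 + k = k ^ 2)%N.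
Proof.
have := sqr_sum_lt (fun _ : 'I_k => 1 : int).
rewrite card_sig !sumr_const card_ord mulr1 -natrX -mulrnA -natrD => /eqP.
by rewrite eqr_nat addnC => /eqP ->.
Qed.

Lemma log2_lt (R : realType) (N : int) (e : nat) : (0 < e)%N -> N < 2 ^+ e ->
  log2 (N%:~R : R) < e%:R.
Proof.
move=> e0 Ne; have ln2 : 0 < ln 2 :> R by rewrite ln_gt0 // ltr1n.
rewrite /log2 ltr_pdivrMr //.
(* For a nonpositive argument [ln] is 0 by convention. *)
case: (lerP (N%:~R : R) 0) => N0; first by rewrite ln0 // mulr_gt0 ?ltr0n.
rewrite mulr_natl -lnXn // ltr_ln ?posrE ?exprn_gt0 //.
by rewrite -[2]/(2%:~R) -rmorphXn ltr_int.
Qed.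

Lemma int01 (z : int) : 0 <= z <= 1 -> z = 0 \/ z = 1.
Proof. by lia. Qed.

Lemma weight_ge0 (k : nat) (i : 'I_2) (c : vars k) : 0 <= weight i c.
Proof. by case: c => [_|[j|[p [[] []]]]] //=; case: ifP. Qed.

Lemma weight_lt (k : nat) (i : 'I_2) (c : vars k) : (0 < k)%N ->
  weight i c < 2 ^+ (2 * k).
Proof.
move=> k0; case: c => [_|[j|[p [[] []]]]] /=; rewrite ?exprn_gt0 //.
  rewrite ltr_eXn2l //; have := ltn_ord j; have := ltn_ord i; nia.
(* From [a < b < k] the exponent [a + b + 1] is at most [2k - 2]. *)
case: ifP => _; rewrite ?exprn_gt0 // ltr_eXn2l //.
by case: p => -[a b] /= ab; have := ltn_ord b; lia.
Qed.

(** * The 0/1 solutions and their projections *)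

Definition cube_mx (k : nat) : 'M[int]_(#|eqns k|, #|vars k|) :=
  \matrix_(i, j) eqn_coef (enum_val i) (enum_val j).

Definition weight_mx (k : nat) : 'M[int]_(2, #|vars k|) :=
  \matrix_(i, j) weight i (enum_val j).

Lemma cube_mx_kernel (k : nat) (x : 'cV[int]_#|vars k|) :
  cube_mx k *m x = 0 -> (forall i, 0 <= x i 0 <= 1) ->
  exists2 v, (v < 2 ^ k)%N & weight_mx k *m x = parabola_point v%:Z.
Proof.
move=> Ax x01; pose X t := x (enum_rank t) 0.
have X01 t : X t = 0 \/ X t = 1 by apply/int01/x01.
have eqnX r : \sum_t eqn_coef r t * X t = 0.
  have := mulmx_enum (fun i => eqn_coef (enum_val i)) x (enum_rank r).
  by rewrite enum_rankK => <-; rewrite -/(cube_mx k) Ax mxE.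
(* The cells sum to [t <= 1], so at most one is 1. If both bits are 1, then the row and the column
   of [true] each contain a 1, which must be their common cell. *)
have CB p : X (inr (inr (p, (true, true)))) =
    X (inr (inl (val p).1)) * X (inr (inl (val p).2)).
  have := eqnX (p, None); have := eqnX (p, Some true).
  have := eqnX (p, Some false); rewrite !sum_eqn_coef /=.
  have [] := X01 (inl tt); have [] := X01 (inr (inr (p, (true, true))));
  have [] := X01 (inr (inr (p, (true, false))));
  have [] := X01 (inr (inr (p, (false, true))));
  have [] := X01 (inr (inr (p, (false, false)))) => -> -> -> -> ->; lia.
pose b i := `|X (inr (inl i))|%N.
have bE i : X (inr (inl i)) = (b i)%:Z by rewrite /b; have [] := X01 (inr (inl i)) => ->.
exists (\sum_(i < k) 2 ^ i * b i)%N.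
  by apply: binary_lt => i; rewrite /b; have [] := X01 (inr (inl i)) => ->.
apply/matrixP => i j; rewrite (ord1 j) mulmx_enum (sum_weight _ _ CB); last first.
  by move=> l; apply: X01.
rewrite mxE; congr (_ ^+ _); rewrite -[RHS]natz natr_sum.
by apply: eq_bigr => l _; rewrite bE natrM natrX [(b l)%:R]natz.
Qed.

Lemma cube_mx_kernel_onto (k v : nat) : (v < 2 ^ k)%N ->
  exists x : 'cV[int]_#|vars k|,
  [/\ cube_mx k *m x = 0, forall i, 0 <= x i 0 <= 1
    & weight_mx k *m x = parabola_point v%:Z].
Proof.
move=> /binary_expansion [b ->].
(* The unit is 1 and each table has its single 1 in the cell of the actual pair of digits. *)
pose X (t : vars k) : int := match t with
  | inl _ => 1
  | inr (inl i) => (b i : nat)%:Z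
  | inr (inr (p, (e, f))) => ((b (val p).1 == e) && (b (val p).2 == f))%:Z
  end.
have XE t : (\col_j X (enum_val j)) (enum_rank t) 0 = X t.
  by rewrite mxE enum_rankK.
exists (\col_j X (enum_val j)); split.
- apply/matrixP => i j; rewrite (ord1 j) [RHS]mxE.
  rewrite (mulmx_enum (fun i => eqn_coef (enum_val i))).
  under eq_bigr do rewrite XE.
  rewrite sum_eqn_coef; case: (enum_val i) => p e /=.
  by case: e => [[]|]; case: (b _); case: (b _).
- have bool01 (c : bool) : 0 <= (c : nat)%:Z <= 1 by case: c.
  by move=> i; rewrite mxE; case: (enum_val i) => [_|[j|[p [e f]]]] //;
    exact: bool01.
- apply/matrixP => i j; rewrite (ord1 j) mulmx_enum.
  under eq_bigr do rewrite XE.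
  rewrite (sum_weight _ (X := X)) => [|l|p] /=.
  + rewrite mxE; congr (_ ^+ _); rewrite -[RHS]natz natr_sum.
    by apply: eq_bigr => l _; rewrite natrM natrX [(b l)%:R]natz.
  + by case: (b l); [right|left].
  + by case: (b _); case: (b _).
Qed.

Theorem theorem3p2 (R : realType) (k : nat) (k_gt0 : (0 < k)%N) :
  exists (m n : nat) (A : 'M[int]_(m, n)) (W : 'M[int]_(2, n)),
    [/\ (0 < m < 2 * k ^ 2)%N /\ (0 < n < 2 * k ^ 2)%N,
        forall i j, A i j \in [:: 0; 1; -1],
        forall i j, 0 <= W i j,
        log2 ((mx_norm W)%:~R : R) < (2 * k)%:R
      & vertices [set intmx R W *m x | x in polytopeQ R A] #= `I_(2 ^ k)].
Proof.
(* For [k = 1] there are no pairs, so the general system has no equations and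
   one variable too many. *)
have [k1|k_neq1] := eqVneq k 1%N.
  (* As 0 and 1 are their own squares, a column of ones sends [x] to [(x, x^2)]. *)
  rewrite k1; exists 1%N, 1%N, 0, (const_mx 1); split=> //.
  - by move=> i j; rewrite mxE.
  - by move=> i j; rewrite mxE.
  - by apply: log2_lt; rewrite // mx_normrE; apply: bigmax_lt => // i _; rewrite mxE.
  - apply: vertices_parabola => [x _ x01|v v2].
      exists (absz (x 0 0)); first by have [] := int01 (x01 0) => ->.
      apply/matrixP => i j; rewrite (ord1 j) !mxE big_ord1 mxE mul1r.
      have [] := int01 (x01 0) => ->; rewrite ?expr1n //=.
      by rewrite expr0n.
    exists (const_mx v%:Z); split=> [|i|]; first exact: mul0mx.
      by rewrite mxE; case: v v2 => [|[|]].
    apply/matrixP => i j; rewrite !mxE big_ord1 !mxE mul1r.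
    by case: v v2 => [|[|//]] _; rewrite ?expr1n // expr0n.
exists #|eqns k|, #|vars k|, (cube_mx k), (weight_mx k); split.
(* Here [m = 3k(k-1)/2] and [n = 1 + k + 2k(k-1) = 2k^2 - k + 1]; both [0 < m] and [n < 2k^2] rely
   on [k > 1]. *)
- have := card_pairs k; rewrite card_prod card_option card_bool.
  rewrite !card_sum card_unit card_ord !card_prod card_bool.
  by nia.
- move=> i j; rewrite mxE; case: (enum_val i) (enum_val j) => p e.
  case=> [_|[l|[q [g h]]]] /=; first by case: eqP.
    by case: e => // e; case: eqP.
  by case: andP.
- by move=> i j; rewrite mxE weight_ge0.
- apply: log2_lt; first by rewrite muln_gt0.
  rewrite mx_normrE; apply: bigmax_lt => [|[i j] _]; first by rewrite exprn_gt0.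
  by rewrite mxE ger0_norm ?weight_ge0 // weight_lt.
- apply: vertices_parabola; first exact: cube_mx_kernel.
  exact: cube_mx_kernel_onto.
Qed.
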